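(* Let $\sigma$ be an anti-involution of the associative algebra $\mathcal D_{as}$ which preserves the principal $\mathbb Z$-gradation, i.e. $\sigma(\mathcal D_{as,j})\subset \mathcal D_{as,j}$ for all $j\in\mathbb Z$. Then $\sigma$ is one of the following, for some $b\in\mathbb C$: 1) $\sigma_{-,b}$, determined by $\sigma_{-,b}(t)=-t$, $\sigma_{-,b}(D)=-D+b$; 2) $\sigma_{+,b}$, determined by $\sigma_{+,b}(t)=t$, $\sigma_{+,b}(D)=-D+b$.
   Context: $\mathcal D_{as}$ is the associative $\mathbb C$-algebra of regular differential operators on the circle. With $D=t\frac{d}{dt}$, it has basis $t^kD^l$ ($k\in\mathbb Z$, $l\ge 0$). The principal $\mathbb Z$-gradation is $\mathcal D_{as}=\bigoplus_j \mathcal D_{as,j}$ with $\mathcal D_{as,j}=\{t^jf(D): f\in\mathbb C[w]\}$. An anti-involution $\sigma$ of $\mathcal D_{as}$ is a $\mathbb C$-linear map $\sigma:\mathcal D_{as}\to\mathcal D_{as}$ with $\sigma^2=\mathrm{id}$ and $\sigma(XY)=\sigma(Y)\sigma(X)$ for all $X,Y$. *)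

(* Defs.v *)
From HB Require Import structures.
From mathcomp Require Import all_boot all_order all_algebra finmap monalg.

Set Implicit Arguments.
Unset Strict Implicit.
Unset Printing Implicit Defensive.

Import GRing.Theory.
Local Open Scope ring_scope.

Section MalgSums.
Variables (K : choiceType) (G W : zmodType) (F : K -> G -> W).
Hypothesis FB : forall k, zmod_morphism (F k).

Lemma sum_msuppEw (d : {fset K}) (g : {malg G[K]}) : (msupp g `<=` d)%fset ->
  \sum_(k <- msupp g) F k g@_k = \sum_(k <- d) F k g@_k.
Proof.
move=> le; rewrite (big_fset_incl _ le) // => k _ /mcoeff_outdom ->.
by rewrite -(subrr 0) FB subrr.
Qed.

Lemma sum_msuppB :
  zmod_morphism (fun g : {malg G[K]} => \sum_(k <- msupp g) F k g@_k).
Proof.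
move=> g1 g2; rewrite (sum_msuppEw (msuppB_le _ _)).
rewrite (sum_msuppEw (fsubsetUl (msupp g1) (msupp g2))).
rewrite (sum_msuppEw (fsubsetUr (msupp g1) (msupp g2))) -sumrB.
by apply: eq_bigr => k _; rewrite mcoeffB FB.
Qed.

Lemma sum_msuppU k c :
  \sum_(i <- msupp << c *g k >>) F i << c *g k >>@_i = F k c.
Proof. by rewrite (sum_msuppEw msuppU_le) big_seq_fset1 mcoeffUU. Qed.

End MalgSums.

Lemma malg_ind (K : choiceType) (G : zmodType) (P : {malg G[K]} -> Prop) :
  P 0 -> (forall c k x, P x -> P (<< c *g k >> + x)) -> forall x, P x.
Proof.
move=> P0 PD x; rewrite [x]monalgE.
elim: (enum_fset (msupp x)) => [|k s IHs]; first by rewrite big_nil.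
by rewrite big_cons; apply: PD.
Qed.

(* The operator \sum_j t^j f_j(D) is encoded by its normal form, the finitely
   supported family (f_j)_j: << f *g j >> stands for t^j f(D). *)
Definition Das (C : comNzRingType) := {malg {poly C}[int]}.

HB.instance Definition _ (C : comNzRingType) :=
  GRing.Zmodule.copy (Das C) {malg {poly C}[int]}.

(* Since D t^k = t^k (D + k), (t^j f(D)) (t^k g(D)) = t^(j+k) f(D + k) g(D). *)
HB.lock Definition das_mul (C : comNzRingType) (x y : Das C) : Das C :=
  \sum_(j <- msupp x) \sum_(k <- msupp y)
    << (x@_j \Po ('X + k%:~R)) * y@_k *g j + k >>.

Arguments das_mul {C}.

Section DasAlgebra.
Variable C : comNzRingType.
Implicit Types (x y z : Das C) (f g h : {poly C}) (j k l : int) (c : C).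

Definition das_term f j : Das C := << f *g j >>.

Lemma das_ind (P : Das C -> Prop) :
  P 0 -> (forall f j x, P x -> P (das_term f j + x)) -> forall x, P x.
Proof. exact: malg_ind. Qed.

Definition das_one : Das C := << 1 *g 0 >>.

Definition das_scale c x : Das C :=
  (c%:P : {poly C}) *: (x : {malg {poly C}[int]}).

Let mono_mul k g j : zmod_morphism (fun f =>
  (<< (f \Po ('X + k%:~R)) * g *g j + k >> : {malg {poly C}[int]})).
Proof. by move=> f1 f2; rewrite comp_polyB mulrBl monalgUB. Qed.

Let mul_mono f j k : zmod_morphism (fun g =>
  (<< (f \Po ('X + k%:~R)) * g *g j + k >> : {malg {poly C}[int]})).
Proof. by move=> g1 g2; rewrite mulrBr monalgUB. Qed.

Lemma das_mulBl y : zmod_morphism (das_mul^~ y).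
Proof.
rewrite unlock; apply: (sum_msuppB (F := fun j f => \sum_(k <- msupp y)
  << (f \Po ('X + k%:~R)) * y@_k *g j + k >>)) => j f1 f2.
by rewrite -sumrB; apply: eq_bigr => k _; rewrite mono_mul.
Qed.

Lemma das_mulBr x : zmod_morphism (das_mul x).
Proof.
move=> y1 y2; rewrite unlock -sumrB; apply: eq_bigr => j _.
exact: (sum_msuppB (mul_mono _ j)).
Qed.

Lemma das_mulUU f g j k :
  das_mul (das_term f j) (das_term g k) =
    das_term ((f \Po ('X + k%:~R)) * g) (j + k).
Proof.
pose F i h := \sum_(l <- msupp << g *g k >>)
  << (h \Po ('X + l%:~R)) * << g *g k >>@_l *g i + l >> : {malg {poly C}[int]}.
rewrite unlock [LHS](sum_msuppU (F := F)); first exact: (sum_msuppU (mul_mono f j)).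
by move=> i f1 f2; rewrite /F -sumrB; apply: eq_bigr => l _; rewrite mono_mul.
Qed.

Let mul0x y : das_mul 0 y = 0.
Proof. by rewrite -{1}(subrr 0) das_mulBl subrr. Qed.
Let mulx0 x : das_mul x 0 = 0.
Proof. by rewrite -{1}(subrr 0) das_mulBr subrr. Qed.

Lemma das_mulDl : left_distributive (das_mul : Das C -> _) +%R.
Proof.
move=> x y z; rewrite -[in LHS](opprK y) das_mulBl; congr (_ + _).
by rewrite -[- y]sub0r das_mulBl mul0x sub0r opprK.
Qed.

Lemma das_mulDr : right_distributive (das_mul : Das C -> _) +%R.
Proof.
move=> x y z; rewrite -[in LHS](opprK z) das_mulBr; congr (_ + _).
by rewrite -[- z]sub0r das_mulBr mulx0 sub0r opprK.
Qed.

Lemma das_mulA : associative (@das_mul C).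
Proof.
move=> x y z.
elim/das_ind: x => [|f j x IHx]; first by rewrite !mul0x.
rewrite !das_mulDl IHx; congr (_ + _) => {x IHx}.
elim/das_ind: y => [|g k y IHy]; first by rewrite mul0x mulx0 mul0x.
rewrite das_mulDl !das_mulDr das_mulDl IHy; congr (_ + _) => {y IHy}.
elim/das_ind: z => [|h l z IHz]; first by rewrite !mulx0.
rewrite !das_mulDr IHz; congr (_ + _).
rewrite !das_mulUU addrA comp_polyM -comp_polyA mulrA.
by rewrite comp_polyD comp_polyX rmorph_int [k + l]addrC intrD addrA.
Qed.

Lemma das_mul1x : left_id das_one (@das_mul C).
Proof.
elim/das_ind => [|f j x IHx]; first exact: mulx0.
rewrite (das_mulDr das_one _ x) IHx; congr (_ + _).
by rewrite das_mulUU rmorph1 mul1r add0r.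
Qed.

Lemma das_mulx1 : right_id das_one (@das_mul C).
Proof.
elim/das_ind => [|f j x IHx]; first exact: mul0x.
rewrite (das_mulDl _ x das_one) IHx; congr (_ + _).
by rewrite das_mulUU /= mulr0z addr0 comp_polyXr mulr1 addr0.
Qed.

Lemma das_one_neq0 : das_one != 0.
Proof. by rewrite monalgU_eq0 oner_eq0. Qed.

HB.instance Definition _ := GRing.Zmodule_isNzRing.Build (Das C)
  das_mulA das_mul1x das_mulx1 das_mulDl das_mulDr das_one_neq0.

Lemma das_scaleA a b x : das_scale a (das_scale b x) = das_scale (a * b) x.
Proof. by rewrite /das_scale scalerA polyCM. Qed.

Lemma das_scale1 : left_id 1 das_scale.
Proof. by move=> x; rewrite /das_scale scale1r. Qed.

Lemma das_scaleDr : right_distributive das_scale +%R.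
Proof. by move=> c x y; rewrite /das_scale scalerDr. Qed.

Lemma das_scaleDl x : {morph das_scale^~ x : a b / a + b}.
Proof. by move=> a b; rewrite /das_scale polyCD scalerDl. Qed.

HB.instance Definition _ := GRing.Zmodule_isLmodule.Build C (Das C)
  das_scaleA das_scale1 das_scaleDr das_scaleDl.

Lemma das_termZ c f j : das_term (c *: f) j = c *: das_term f j.
Proof.
apply/malgP => k; rewrite mcoeffZ !mcoeffU.
by case: eqP => _; rewrite ?mulr1n ?mulr0n ?mulr0 // mul_polyC.
Qed.


Lemma das_scaleAl c x y : c *: (x * y) = (c *: x) * y.
Proof.
elim/das_ind: x => [|f j x IHx]; first by rewrite mul0r scaler0 mul0r.
rewrite mulrDl !scalerDr mulrDl IHx; congr (_ + _) => {x IHx}.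
elim/das_ind: y => [|g k y IHy]; first by rewrite !mulr0 scaler0.
rewrite !mulrDr scalerDr IHy -das_termZ; congr (_ + _).
by rewrite [_ * _]das_mulUU [RHS]das_mulUU comp_polyZ -scalerAl das_termZ.
Qed.

HB.instance Definition _ := GRing.Lmodule_isLalgebra.Build C (Das C) das_scaleAl.

Lemma das_scaleAr c x y : c *: (x * y) = x * (c *: y).
Proof.
elim/das_ind: x => [|f j x IHx]; first by rewrite !mul0r scaler0.
rewrite !mulrDl !scalerDr IHx; congr (_ + _) => {x IHx}.
elim/das_ind: y => [|g k y IHy]; first by rewrite !(mulr0, scaler0).
rewrite !(mulrDr, scalerDr) IHy -das_termZ; congr (_ + _).
by rewrite [_ * _]das_mulUU [RHS]das_mulUU -scalerAr das_termZ.
Qed.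

HB.instance Definition _ := GRing.Lalgebra_isAlgebra.Build C (Das C) das_scaleAr.

Lemma das_termM f g j k :
  das_term f j * das_term g k = das_term ((f \Po ('X + k%:~R)) * g) (j + k).
Proof. exact: das_mulUU. Qed.

Lemma das_term0D f g : das_term (f + g) 0 = das_term f 0 + das_term g 0.
Proof. exact: monalgUD. Qed.

End DasAlgebra.

Definition das_tpow (C : comNzRingType) (j : int) : Das C := das_term 1 j.
Definition das_t (C : comNzRingType) : Das C := das_tpow C 1.
Definition das_D (C : comNzRingType) : Das C := das_term 'X 0.
Arguments das_tpow {C} j.
Arguments das_t {C}.
Arguments das_D {C}.

Section DasPresentation.
Variable C : comNzRingType.
Implicit Types (f : {poly C}) (j k : int).

Lemma das_tpow0 : das_tpow 0 = 1 :> Das C. Proof. by []. Qed.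

Lemma das_tpowD j k : das_tpow (j + k) = das_tpow j * das_tpow k :> Das C.
Proof. by rewrite das_termM rmorph1 mulr1. Qed.

Lemma das_Dt : das_D * das_t = das_t * (das_D + 1) :> Das C.
Proof.
rewrite mulrDr mulr1 !das_termM comp_polyX !rmorph1.
rewrite mulr1 add0r addr0 mul1r.
by rewrite [LHS]monalgUD.
Qed.

Lemma das_termE f j : das_term f j = das_tpow j * horner_alg das_D f.
Proof.
have -> : horner_alg das_D f = das_term f 0 :> Das C.
  elim/poly_ind: f => [|f c IHf]; first by rewrite rmorph0 /das_term monalgU0.
  rewrite rmorphD rmorphM /= horner_algX horner_algC IHf das_termM addr0.
  by rewrite addr0 comp_polyXr das_term0D -alg_polyC das_termZ.
by rewrite das_termM rmorph1 mul1r addr0.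
Qed.

Lemma das_tpowD_exp (k : int) (l : nat) :
  das_tpow k * das_D ^+ l = das_term 'X^l k :> Das C.
Proof. by rewrite das_termE rmorphXn /= horner_algX. Qed.

(* Together with malgP, which says that the x@_j are determined by x, this is
   the basis property of the t^j D^l. *)
Lemma das_expand (x : Das C) :
  x = \sum_(j <- msupp x) das_tpow j * horner_alg das_D x@_j.
Proof.
by rewrite [LHS]monalgE; apply: eq_bigr => j _; rewrite -das_termE.
Qed.

End DasPresentation.

(* The action of x on Laurent polynomials, with t^j f(D) . t^n = f(n) t^(j+n),
   where p : {malg C[int]} stands for \sum_n p_n t^n. *)
HB.lock Definition das_act (C : comNzRingType)
    (x : Das C) (p : {malg C[int]}) : {malg C[int]} :=
  \sum_(j <- msupp x) \sum_(n <- msupp p) << (x@_j).[n%:~R] * p@_n *g j + n >>.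
Arguments das_act {C}.

Section DasAction.
Variable C : comNzRingType.
Implicit Types (x y : Das C) (p : {malg C[int]}) (f : {poly C}) (j n : int).

Let act_l j c n : zmod_morphism (fun f =>
  (<< f.[n%:~R] * c *g j + n >> : {malg C[int]})).
Proof. by move=> f1 f2; rewrite hornerD hornerN mulrBl monalgUB. Qed.

Let act_r f j n : zmod_morphism (fun c =>
  (<< f.[n%:~R] * c *g j + n >> : {malg C[int]})).
Proof. by move=> c1 c2; rewrite mulrBr monalgUB. Qed.

Lemma das_actBl p : zmod_morphism (das_act^~ p).
Proof.
rewrite unlock; apply: (sum_msuppB (F := fun j f => \sum_(n <- msupp p)
  << f.[n%:~R] * p@_n *g j + n >>)) => j f1 f2.
by rewrite -sumrB; apply: eq_bigr => n _; rewrite act_l.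
Qed.

Lemma das_actBr x : zmod_morphism (das_act x).
Proof.
move=> p q; rewrite unlock -sumrB; apply: eq_bigr => j _.
exact: (sum_msuppB (act_r _ j)).
Qed.

HB.instance Definition _ x :=
  GRing.isZmodMorphism.Build _ _ (das_act x) (das_actBr x).

Lemma das_actUU f c j n :
  das_act (das_term f j) << c *g n >> = << f.[n%:~R] * c *g j + n >>.
Proof.
pose F i h := \sum_(l <- msupp << c *g n >>)
  << h.[l%:~R] * << c *g n >>@_l *g i + l >> : {malg C[int]}.
rewrite unlock [LHS](sum_msuppU (F := F)); first exact: (sum_msuppU (act_r f j)).
by move=> i f1 f2; rewrite /F -sumrB; apply: eq_bigr => l _; rewrite act_l.
Qed.

Lemma das_act_t c n : das_act (das_t : Das C) << c *g n >> = << c *g n + 1 >>.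
Proof. by rewrite das_actUU hornerC mul1r addrC. Qed.

(* das_D acts as t d/dt. *)
Lemma das_act_D c n : das_act (das_D : Das C) << c *g n >> = << c *~ n *g n >>.
Proof. by rewrite das_actUU hornerX add0r mulrzl. Qed.

Let act0p p : das_act 0 p = 0.
Proof. by rewrite -{1}(subrr 0) das_actBl subrr. Qed.

Lemma das_actDl p : {morph das_act^~ p : x y / x + y}.
Proof.
move=> x y; rewrite -[in LHS](opprK y) das_actBl; congr (_ + _).
by rewrite -[- y]sub0r das_actBl act0p sub0r opprK.
Qed.

Lemma das_actM x y p : das_act (x * y) p = das_act x (das_act y p).
Proof.
elim/das_ind: x => [|f j x IHx]; first by rewrite mul0r !act0p.
rewrite mulrDl !das_actDl IHx; congr (_ + _) => {x IHx}.
elim/das_ind: y => [|g k y IHy]; first by rewrite mulr0 !act0p raddf0.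
rewrite mulrDr !das_actDl raddfD /= IHy; congr (_ + _) => {y IHy}.
elim/malg_ind: p => [|c n p IHp]; first by rewrite !raddf0.
rewrite !raddfD /= IHp das_termM !das_actUU hornerM horner_comp; congr (_ + _).
by rewrite hornerD hornerX hornerMz hornerC -intrD [n + k]addrC mulrA addrA.
Qed.

Lemma das_act1 p : das_act (1 : Das C) p = p.
Proof.
elim/malg_ind: p => [|c n p IHp]; first by rewrite raddf0.
by rewrite raddfD /= IHp das_actUU hornerC mul1r add0r.
Qed.

Lemma das_act_coef x j n : (das_act x << 1 *g n >>)@_(j + n) = (x@_j).[n%:~R].
Proof.
elim/das_ind: x => [|f k x IHx]; first by rewrite act0p !mcoeff0 horner0.
rewrite das_actDl !mcoeffD IHx hornerD; congr (_ + _).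
rewrite das_actUU mulr1 !mcoeffU (inj_eq (addIr n)).
by case: eqP; rewrite ?mulr1n ?mulr0n ?horner0.
Qed.

End DasAction.

(* Das C is thus faithfully an algebra of operators on C[t, t^-1]. *)
Lemma das_act_inj (C : numDomainType) (x y : Das C) :
  das_act x =1 das_act y -> x = y.
Proof.
move=> xy; apply/malgP => j; apply/eqP; rewrite -subr_eq0; apply/eqP.
set q := _ - _.
have rq (n : nat) : root q n%:R.
  by rewrite pmulrn /root hornerD hornerN -!das_act_coef xy subrr.
apply: (@roots_geq_poly_eq0 _ _ [seq n%:R | n <- iota 0 (size q)]).
- by apply/allP => _ /mapP[n _ ->].
- by rewrite map_inj_uniq ?iota_uniq //; apply: Num.Theory.mulrIn (oner_neq0 _).
- by rewrite size_map size_iota.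
Qed.

Definition anti_involution (C : comNzRingType) (A : algType C)
    (s : {linear A -> A}) : Prop :=
  involutive s /\ (forall x y, s (x * y) = s y * s x).

Definition das_homog (C : comNzRingType) (j : int) (x : Das C) : Prop :=
  exists f : {poly C}, x = das_tpow j * horner_alg das_D f.

Definition preserves_gradation (C : comNzRingType)
    (s : {linear Das C -> Das C}) : Prop :=
  forall j x, das_homog j x -> das_homog j (s x).

Definition anti_involution_determined_by (C : comNzRingType)
    (s : {linear Das C -> Das C}) (u v : Das C) : Prop :=
  [/\ anti_involution s, s das_t = u, s das_D = v
    & forall s' : {linear Das C -> Das C},
        anti_involution s' -> s' das_t = u -> s' das_D = v -> s' =1 s].

Definition is_sigma_minus (C : comNzRingType) (b : C)
    (s : {linear Das C -> Das C}) : Prop :=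
  anti_involution_determined_by s (- das_t) (- das_D + b%:A).

Definition is_sigma_plus (C : comNzRingType) (b : C)
    (s : {linear Das C -> Das C}) : Prop :=
  anti_involution_determined_by s das_t (- das_D + b%:A).

(* Main.v *)
From HB Require Import structures.
Require Import Defs.
From mathcomp Require Import all_boot all_order all_algebra.
From mathcomp Require Import finmap monalg ring.
From mathcomp Require Import reals complex.
Set Implicit Arguments.
Unset Strict Implicit.
Unset Printing Implicit Defensive.
Local Open Scope ring_scope.

(** The element [t] is invertible and [s t = t f(D)] with [f(D)] again
    invertible, so [f] is a constant [a], and [s (s t) = t] forces [a^2 = 1].
    Applying [s] to [D t = t (D + 1)], with [s D = h(D)], gives
    [h(w) = h(w + 1) + 1], so [h(w) + w] is a polynomial of period 1, hence
    constant in characteristic 0.  Conversely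
    [t^j f(D) |-> a^j f(b - D) t^j = a^j t^j f(b - j - D)] is an anti-involution
    as soon as [a^2 = 1]. *)

Import GRing.Theory Num.Theory.

(** * Anti-involutions of a general algebra *)

Section AntiInvolutions.
Variables (C : comNzRingType) (A : algType C) (s : {linear A -> A}).
Hypothesis s_anti : anti_involution s.

Lemma anti_involution1 : s 1 = 1.
Proof.
case: s_anti => sK sM.
by rewrite -[LHS]mulr1 -[X in _ * X]sK -sM mulr1 sK.
Qed.

Lemma anti_involutionX n x : s (x ^+ n) = s x ^+ n.
Proof.
case: s_anti => _ sM.
by elim: n => [|n IHn]; rewrite ?anti_involution1 // exprS sM IHn exprSr.
Qed.

(** Powers of a single element commute, so the reversal of products is invisible on polynomials in
    [x]. *)
Lemma anti_involution_horner x f :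
  s (horner_alg x f) = horner_alg (s x) f.
Proof.
case: s_anti => _ sM; elim/poly_ind: f => [|f c IHf]; first by rewrite !rmorph0 linear0.
rewrite !rmorphD !rmorphM /= !horner_algX !horner_algC linearD linearZ sM IHf /=.
rewrite anti_involution1; congr (_ + _).
(* Writing [s x] as the value of ['X] moves the commutation into the commutative ring [{poly C}]. *)
by rewrite -[X in X * _](horner_algX (s x)) -!rmorphM mulrC rmorphM /= horner_algX.
Qed.

End AntiInvolutions.

(** * Values on [t] and [D] determine an anti-involution *)

Section DasAntiInvolutions.
Variable C : comNzRingType.
Implicit Types (s : {linear Das C -> Das C}) (f g : {poly C}) (j k : int).

Lemma das_term_inj j : injective (fun f => das_term f j).
Proof. by move=> f g /(congr1 (mcoeff j)); rewrite !mcoeffUU. Qed.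

Lemma das_term_affine (b : C) : das_term (- 'X + b%:P) 0 = - das_D + b%:A.
Proof. by rewrite das_term0D -alg_polyC das_termZ; congr (_ + _); apply: monalgUN. Qed.

Lemma das_homogP j (x : Das C) :
  das_homog j x <-> exists f, x = das_term f j.
Proof. by split=> -[f ->]; exists f; rewrite das_termE. Qed.

Lemma das_tpow_nat (n : nat) : das_tpow n = das_t ^+ n :> Das C.
Proof.
by elim: n => [|n IHn] //; rewrite exprS -IHn -das_tpowD -intS.
Qed.

Lemma anti_involution_tpow s s' : anti_involution s -> anti_involution s' ->
  s das_t = s' das_t -> forall j, s (das_tpow j) = s' (das_tpow j).
Proof.
move=> Hs Hs' st.
have pos (n : nat) : s (das_tpow n) = s' (das_tpow n).
  by rewrite das_tpow_nat !anti_involutionX // st.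
case=> n; first exact: pos.
(* For a negative exponent, [y] is a left inverse and [y'] a right inverse of the same element, so
   they agree. *)
rewrite NegzE; set y := s _; set y' := s' _.
have yx : y * s (das_tpow n.+1) = 1.
  by rewrite -(proj2 Hs) -das_tpowD addrN anti_involution1.
have xy' : s (das_tpow n.+1) * y' = 1.
  by rewrite pos -(proj2 Hs') -das_tpowD addNr anti_involution1.
by rewrite -[y]mulr1 -xy' mulrA yx mul1r.
Qed.

Lemma anti_involution_determined s : anti_involution s ->
  anti_involution_determined_by s (s das_t) (s das_D).
Proof.
move=> Hs; split=> // s' Hs' st sD x.
rewrite (das_expand x) !linear_sum; apply: eq_bigr => j _.
rewrite (proj2 Hs) (proj2 Hs') !anti_involution_horner // sD.
by rewrite (anti_involution_tpow Hs' Hs st).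
Qed.

End DasAntiInvolutions.

(** By periodicity [p - p(0)] vanishes at every natural number, and these are pairwise distinct in
    characteristic 0. *)
Lemma periodic_poly_const (C : numDomainType) (p : {poly C}) :
  p \Po ('X + 1) = p -> p = (p.[0])%:P.
Proof.
move=> pp; apply/eqP; rewrite -subr_eq0; apply/eqP; set q := _ - _.
have p_nat (n : nat) : p.[n%:R] = p.[0].
  by elim: n => // n <-; rewrite -{2}pp horner_comp hornerD hornerX hornerC -natr1.
apply: (@roots_geq_poly_eq0 _ _ [seq n%:R | n <- iota 0 (size q)]).
- by apply/allP => _ /mapP[n _ ->]; rewrite /root hornerD hornerN hornerC p_nat subrr.
- by rewrite map_inj_uniq ?iota_uniq //; apply: mulrIn (oner_neq0 _).
- by rewrite size_map size_iota.
Qed.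

(** * Classification of the graded anti-involutions *)

Section GradedAntiInvolutions.
Variables (C : numFieldType) (s : {linear Das C -> Das C}).
Hypotheses (s_anti : anti_involution s) (s_graded : preserves_gradation s).

Let s_term f j : exists g, s (das_term f j) = das_term g j.
Proof. by apply/das_homogP/s_graded/das_homogP; exists f. Qed.

Lemma graded_anti_involution_t : s das_t = das_t \/ s das_t = - das_t.
Proof.
have [sK sM] := s_anti.
have [f sf] := s_term 1 1; have [g sg] := s_term 1 (-1).
have : das_term g (-1) * das_term f 1 = 1.
  by rewrite -sg -sf -sM -das_tpowD addrN anti_involution1.
rewrite das_termM addNr => /das_term_inj gf.
(* Here [gf] says [g(w + 1) f(w) = 1], and the units of a polynomial ring over a field are the
   nonzero constants. *)
have /size_poly1P[a _ fa] : size f == 1.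
  have : f \is a GRing.unit by apply/unitrPr; exists (g \Po ('X + 1%:~R)); rewrite mulrC.
  by rewrite poly_unitE => /andP[].
have sta : s das_t = a *: das_t by rewrite /das_t /das_tpow sf fa -das_termZ alg_polyC.
have : a ^+ 2 == 1.
  have := sK das_t; rewrite sta linearZ /= sta scalerA -das_termZ.
  move=> /das_term_inj/(congr1 (horner^~ 0)); rewrite hornerZ hornerC mulr1.
  by rewrite expr2 => ->.
by rewrite sqrf_eq1 => /orP[]/eqP aE; [left|right]; rewrite sta aE ?scale1r ?scaleN1r.
Qed.

Lemma graded_anti_involution_D : exists b : C, s das_D = - das_D + b%:A.
Proof.
have [_ sM] := s_anti; have [h sh] := s_term 'X 0.
(* This is the image of [D t = t (D + 1)]; the sign of [s t] occurs once in each term and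
   cancels. *)
have : das_t * s das_D = s das_D * das_t + das_t.
  have := congr1 s (das_Dt C); rewrite !sM linearD /= (anti_involution1 s_anti) mulrDl mul1r.
  case: graded_anti_involution_t => -> //.
  by rewrite mulNr mulrN -opprD => /oppr_inj.
rewrite /das_D sh !das_termM !rmorph1 mul1r mulr1 addr0 add0r -[RHS]monalgUD.
(* Moving [t] to the left of [h(D)] shifts the argument, so [hE] reads [h(w) = h(w + 1) + 1]. *)
move=> /das_term_inj hE.
have /periodic_poly_const hX : (h + 'X) \Po ('X + 1) = h + 'X.
  by rewrite rmorphD /= comp_polyX [in RHS]hE addrCA addrC -addrA [1 + _]addrC.
by exists (h + 'X).[0]; rewrite -das_term_affine -hX addrC addrK.
Qed.

End GradedAntiInvolutions.

(** * Construction of both families, with [a] standing for the sign *)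

Section Sigma.
Variables (C : fieldType) (a b : C).
Implicit Types (f g : {poly C}) (j k : int) (x y : Das C).

(** The shift by [-j] comes from putting [a^j f(b - D) t^j] in normal form, with [t^j] on the
    left. *)
Definition sigma_coef j f : {poly C} :=
  a ^ j *: (f \Po (b%:P - j%:~R - 'X)).

Definition sigma_map x : Das C :=
  \sum_(j <- msupp x) das_term (sigma_coef j x@_j) j.

Let sigma_term_is_zmod j :
  zmod_morphism (fun f => das_term (sigma_coef j f) j : {malg {poly C}[int]}).
Proof. by move=> f g; rewrite /sigma_coef comp_polyB scalerBr /das_term monalgUB. Qed.

Lemma sigma_mapB : zmod_morphism sigma_map.
Proof. exact: (sum_msuppB sigma_term_is_zmod). Qed.

HB.instance Definition _ :=
  GRing.isZmodMorphism.Build (Das C) (Das C) sigma_map sigma_mapB.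

Lemma sigma_mapU f j : sigma_map (das_term f j) = das_term (sigma_coef j f) j.
Proof. exact: (sum_msuppU sigma_term_is_zmod). Qed.

Lemma sigma_mapZ : scalable sigma_map.
Proof.
move=> c; elim/das_ind => [|f j x IHx]; first by rewrite scaler0 raddf0 scaler0.
rewrite !raddfD /= IHx -das_termZ !sigma_mapU -das_termZ.
by rewrite /sigma_coef comp_polyZ !scalerA mulrC.
Qed.

HB.instance Definition _ :=
  GRing.isScalable.Build C (Das C) (Das C) *:%R sigma_map sigma_mapZ.

Hypothesis a2 : a ^+ 2 = 1.

Let a_neq0 : a != 0.
Proof. by apply/eqP => a0; move/eqP: a2; rewrite a0 expr0n eq_sym oner_eq0. Qed.

Lemma sigma_map_anti : anti_involution (sigma_map : {linear Das C -> Das C}).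
Proof.
split=> [x|x y] /=.
  elim/das_ind: x => [|f j x IHx]; first by rewrite !raddf0.
  rewrite !raddfD /= IHx !sigma_mapU; congr (das_term _ _ + _).
  (* The substitution [w |-> b - j - w] is its own inverse, and the scalars give [(a * a)^j = 1]. *)
  rewrite /sigma_coef comp_polyZ scalerA -expfzMl -comp_polyA.
  rewrite !rmorphB /= comp_polyC rmorph_int comp_polyX subKr comp_polyXr.
  by rewrite -expr2 a2 exp1rz scale1r.
elim/das_ind: x => [|f j x IHx]; first by rewrite mul0r !raddf0 mulr0.
rewrite mulrDl !raddfD /= IHx mulrDr; congr (_ + _) => {x IHx}.
elim/das_ind: y => [|g k y IHy]; first by rewrite mulr0 !raddf0 mul0r.
rewrite mulrDr !raddfD /= IHy mulrDl; congr (_ + _) => {y IHy}.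
rewrite das_termM !sigma_mapU das_termM [k + j]addrC; congr das_term.
rewrite /sigma_coef comp_polyZ -scalerAl -scalerAr scalerA expfzDr // [_ * a ^ k]mulrC.
(* Coefficients commute, so the factors can be matched: on both sides [g] is taken at
   [b - j - k - w] and [f] at [b - j - w]. *)
rewrite comp_polyM [_ * (g \Po _)]mulrC -!comp_polyA; congr (_ *: ((_ \Po _) * (_ \Po _))).
  rewrite !rmorphB /= comp_polyC rmorph_int comp_polyX intrD.
  by ring.
by rewrite rmorphD /= comp_polyX rmorph_int intrD; ring.
Qed.

Lemma sigma_map_t : sigma_map das_t = a *: das_t.
Proof. by rewrite sigma_mapU /sigma_coef comp_polyC -das_termZ expr1z. Qed.

Lemma sigma_map_D : sigma_map das_D = - das_D + b%:A.
Proof.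
rewrite sigma_mapU /sigma_coef comp_polyX expr0z scale1r mulr0z subr0 addrC.
exact: das_term_affine.
Qed.

Lemma sigma_exists : exists s : {linear Das C -> Das C},
  anti_involution_determined_by s (a *: das_t) (- das_D + b%:A).
Proof.
exists (sigma_map : {linear Das C -> Das C}).
by rewrite -sigma_map_t -sigma_map_D; apply/anti_involution_determined/sigma_map_anti.
Qed.

End Sigma.

Theorem proposition2p1 (R : realType) :
  (forall sigma : {linear Das R[i] -> Das R[i]},
     anti_involution sigma -> preserves_gradation sigma ->
     exists b : R[i], is_sigma_minus b sigma \/ is_sigma_plus b sigma) /\
  (forall b : R[i],
     (exists sigma : {linear Das R[i] -> Das R[i]}, is_sigma_minus b sigma) /\
     (exists sigma : {linear Das R[i] -> Das R[i]}, is_sigma_plus b sigma)).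
Proof.
split=> [s s_anti s_graded|b].
  have [b sD] := graded_anti_involution_D s_anti s_graded.
  exists b; have := anti_involution_determined s_anti; rewrite sD.
  by case: (graded_anti_involution_t s_anti s_graded) => ->; [right|left].
split.
  (* The two families are the cases [a = -1] and [a = 1] of one construction. *)
  by rewrite /is_sigma_minus -scaleN1r; apply: sigma_exists; rewrite sqrrN expr1n.
by rewrite /is_sigma_plus -[das_t]scale1r; apply: sigma_exists; rewrite expr1n.
Qed.
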